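(* Let $x,y,n,u,d$ be nonnegative integers with $u,d\le n$, and let $U=\{s_1<s_2<\dots<s_u\}$, $D=\{t_1<t_2<\dots<t_d\}$, $U'=\{s'_1<s'_2<\dots<s'_u\}$, $D'=\{t'_1<t'_2<\dots<t'_d\}$ be subsets of $[x+y+n]$ such that $|U\cup D|=n$, $U\cup D=U'\cup D'$ and $U\cap D=U'\cap D'$. Then $$\frac{\operatorname{M}(H_{x,y}(U;D))}{\operatorname{M}(H_{x,y}(U';D'))}=\prod_{1\le i<j\le u}\frac{s_j-s_i}{s'_j-s'_i}\ \prod_{1\le i<j\le d}\frac{t_j-t_i}{t'_j-t'_i}.$$
   Context: Notation: $[m]=\{1,2,\dots,m\}$. Work on the triangular lattice of the plane with unit-side equilateral triangles, drawn so that one family of lattice lines is horizontal. Each unit triangle is up-pointing (horizontal edge at the bottom) or down-pointing (horizontal edge at the top). A lozenge is the union of two unit triangles sharing an edge. A (lozenge) tiling of a region (a finite union of unit triangles) is a covering of the region by lozenges contained in it, with no gaps and no overlaps. $\operatorname{M}(R)$ denotes the number of lozenge tilings of the region $R$. Definition of $H_{x,y}(U;D)$: let $U,D\subseteq[x+y+n]$ (not necessarily disjoint) with $|U|=u$, $|D|=d$, $|U\cup D|=n$. Consider the lattice hexagon with all angles $120^\circ$ and side lengths $x+n-u,\ y+u,\ y+d,\ x+n-d,\ y+d,\ y+u$ in clockwise order starting from the (horizontal) north side; sides of length $0$ are allowed. Let $l$ be the horizontal lattice line through the west and east vertices of the hexagon; its part inside the hexagon has length $x+y+n$ and consists of unit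 segments labelled $1,2,\dots,x+y+n$ from left to right. The up-pointing unit triangle at position $i$ is the one lying just above $l$ whose bottom edge is the $i$-th segment; the down-pointing unit triangle at position $i$ is the one lying just below $l$ whose top edge is the $i$-th segment. $H_{x,y}(U;D)$ is the region obtained from the hexagon by removing the up-pointing unit triangles at the positions in $U$ and the down-pointing unit triangles at the positions in $D$. *)

(* Defs.v *)
From mathcomp Require Import all_boot all_order all_algebra finmap.

Set Implicit Arguments.
Unset Strict Implicit.
Unset Printing Implicit Defensive.

Import GRing.Theory Num.Theory.
Local Open Scope fset_scope.
Local Open Scope ring_scope.

(* The lattice point (a, b) stands for a * e1 + b * e2, where e1 is the
   horizontal unit vector and e2 the unit vector at angle 60 degrees. *)
Definition point : Type := (int * int)%type.

(* (a, b, true) is the up-pointing unit triangle with bottom edge from (a, b)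
   to (a + 1, b); (a, b, false) is the down-pointing unit triangle with top
   edge from (a, b + 1) to (a + 1, b + 1). *)
Definition triangle : Type := (int * int * bool)%type.

Definition vertices (t : triangle) : {fset point} :=
  let: (a, b, up) := t in
  if up then [fset (a, b); (a + 1, b); (a, b + 1)]
  else [fset (a, b + 1); (a + 1, b + 1); (a + 1, b)].

(* Two unit triangles share an edge when they have exactly two common
   vertices. *)
Definition share_edge (t t' : triangle) : bool :=
  #|` vertices t `&` vertices t'| == 2.

Definition is_lozenge (R : {fset triangle}) (L : {set R}) : bool :=
  [exists t : R, exists t' : R,
     share_edge (val t) (val t') && (L == [set t; t'])].

Definition is_tiling (R : {fset triangle}) (P : {set {set R}}) : bool :=
  partition P [set: R] && [forall L in P, is_lozenge L].

Definition M (R : {fset triangle}) : nat :=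
  #|[set P : {set {set R}} | is_tiling P]|.

(* The hexagon with side lengths x + n - u, y + u, y + d, x + n - d, y + d,
   y + u, placed with its west corner at the origin. Its corners, clockwise
   from the west one, are (0, 0), (0, y + u), (x + n - u, y + u),
   (x + y + n, 0), (x + y + n, - (y + d)), (y + d, - (y + d)), so that the
   lines bounding it are those of the inequalities below. *)
Definition in_hexagon (x y n u d : nat) (p : point) : bool :=
  [&& 0 <= p.1 <= (x + y + n)%:Z,
      0 <= p.1 + p.2 <= (x + y + n)%:Z
    & - (y + d)%:Z <= p.2 <= (y + u)%:Z].

(* The sequence over which t ranges only serves to make the set finite: it
   covers every triangle with its three vertices in the hexagon. *)
Definition hexagon (x y n u d : nat) : {fset triangle} :=
  [fset t in [seq ((v.1.1 : nat)%:Z, (v.1.2 : nat)%:Z - (y + d)%:Z, v.2)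
                | v : 'I_(x + y + n) * 'I_((y + d) + (y + u)) * bool]
   | all (in_hexagon x y n u d) (vertices t)].

(* The horizontal line l is b = 0, and the element k of 'I_(x + y + n) stands
   for the position k + 1, whose segment goes from (k, 0) to (k + 1, 0). *)
Definition up_at (m : nat) (k : 'I_m) : triangle :=
  ((k : nat)%:Z, 0, true).

Definition down_at (m : nat) (k : 'I_m) : triangle :=
  ((k : nat)%:Z, -1, false).

Definition H (x y n : nat) (U D : {set 'I_(x + y + n)}) : {fset triangle} :=
  hexagon x y n #|U| #|D|
    `\` ([fset up_at k | k in U] `|` [fset down_at k | k in D]).

Arguments H x y n U D : clear implicits.

(* Main.v *)
Require Import Defs.
From mathcomp Require Import all_boot all_order all_algebra finmap.
From mathcomp Require Import perm zify ring.
Import Order.TTheory GRing.Theory Num.Theory.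
Set Implicit Arguments.
Unset Strict Implicit.
Unset Printing Implicit Defensive.
Local Open Scope fset_scope.
Local Open Scope ring_scope.

(** Cut the hexagon along the axis l and record the set Y of positions at
which a lozenge straddles l.  Y avoids U and D, and once it is fixed the two
halves are tiled independently: the upper one is a trapezoid with dents at
U :|: Y along its long base, the lower one the mirror image of a trapezoid
with dents at D :|: Y ([M_split], [H_halves], [M_H_split]).

The number of tilings of a trapezoid of height h with h dents is, up to a
constant depending on h only, the Vandermonde product of the positions of the
dents ([M_trapezoid], [binom_det_Vandermonde]).  Indeed the vertical lozenges
that leave the bottom row form an arbitrary set interlacing with the dents,
and serve as dents for the trapezoid above; so the numbers of tilings satisfy
a recursion by interlacing sums ([trapezoid_peel]), which the determinants of
binomial coefficients satisfy as well, because summing one binomial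
coefficient over an interval raises its lower index
([interlacing_sum_binom_det]).  If the number of dents differs from h, there
is no tiling, whence #|Y| = y ([trapezoid_unbalanced]).

Finally the Vandermonde product of a disjoint union U :|: Y is the product of
those of U, of Y, and of the distances between U and Y
([Vandermonde_prodU]).  Multiplying the expressions for U and D, the distances
to Y enter only through U :|: D and U :&: D, so the sum over Y is
V(U) V(D) K, where K > 0 depends only on U :|: D, U :&: D and y
([M_H_formula], [mixed_sum_gt0]).  In the quotient K cancels. *)

(** * Counting tilings as matchings *)

Definition is_edge (T : finType) (e : rel T) (L : {set T}) : bool :=
  [exists t, exists t', e t t' && (L == [set t; t'])].

Definition matchings (T : finType) (e : rel T) (A : {set T}) :=
  [set P : {set {set T}} | partition P A && [forall L in P, is_edge e L]].

Lemma card_matchings0 (T : finType) (e : rel T) : #|matchings e set0| = 1%N.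
Proof.
rewrite (_ : matchings e set0 = [set set0]) ?cards1 //.
apply/setP => P; rewrite !inE partition_set0 andb_idr // => /eqP ->.
by apply/forall_inP => L; rewrite inE.
Qed.

(** Adding or removing the block [set t; t'] is a bijection. *)
Lemma card_matchings_edge (T : finType) (e : rel T) (A : {set T}) t t' :
  t \in A -> t' \in A -> e t t' ->
  #|[set P in matchings e A | [set t; t'] \in P]|
  = #|matchings e (A :\: [set t; t'])|.
Proof.
move=> tA t'A ett'; set L := [set t; t'].
have sLA : L \subset A by apply/subsetP => z /set2P[] ->.
have L0 : L != set0 by apply/set0Pn; exists t; rewrite set21.
have notin (Q : {set {set T}}) : Q \in matchings e (A :\: L) -> L \notin Q.
  rewrite inE => /andP[/and3P[/eqP covQ _ _] _]; apply/negP => LQ.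
  have: t \in cover Q by apply/bigcupP; exists L => //; rewrite set21.
  by rewrite covQ inE set21.
rewrite -(card_in_imset (f := fun Q => L |: Q) (D := mem (matchings e (A :\: L)))).
  apply: eq_card => P; apply/idP/imsetP => [|[Q QM ->]].
    rewrite !inE => /andP[/andP[PA /forall_inP Pe] LP].
    exists (P :\ L); last by rewrite setD1K.
    rewrite inE partitionD1 //=; apply/forall_inP => K.
    by rewrite inE => /andP[_ /Pe].
  have LQ := notin _ QM; move: QM; rewrite !inE eqxx andbT /=.
  move=> /andP[QA /forall_inP Qe]; apply/andP; split.
    rewrite -(setID A L) (setIidPr sLA).
    by apply: partitionU1 => //; rewrite -setI_eq0 setDE setICA setICr setI0.
  apply/forall_inP => K; rewrite in_setU1 => /orP[/eqP -> | /Qe //].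
  by apply/existsP; exists t; apply/existsP; exists t'; rewrite ett' eqxx.
move=> Q Q' /notin LQ /notin LQ' /(congr1 (fun P => P :\ L)).
by rewrite !setU1K.
Qed.

(** Each matching covers t by exactly one edge; the sum runs over its other
end. *)
Lemma card_matchings_rec (T : finType) (e : rel T) (A : {set T}) t :
    irreflexive e -> symmetric e -> t \in A ->
  #|matchings e A| =
  (\sum_(t' in A | e t t') #|matchings e (A :\: [set t; t'])|)%N.
Proof.
move=> eI eS tA.
transitivity (\sum_(t' in A | e t t') \sum_(P in matchings e A)
    if [set t; t'] \in P then 1 else 0)%N; last first.
  apply: eq_bigr => t' /andP[t'A ett'].
  rewrite -card_matchings_edge // -sum1_card -big_mkcondr.
  by apply: eq_bigl => P; rewrite [in RHS]inE.
rewrite exchange_big /= -sum1_card; apply: eq_bigr => P.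
rewrite inE => /andP[PA /forall_inP Pe].
have /and3P[/eqP covP trivP P0] := PA.
have neq (t1 t2 : T) : e t1 t2 -> t1 != t2.
  by apply: contraTneq => ->; rewrite eI.
have [t' [t'A ett' tP]] : exists t', [/\ t' \in A, e t t' & [set t; t'] \in P].
  have /bigcupP[L LP tL] : t \in cover P by rewrite covP.
  have /existsP[t1 /existsP[t2 /andP[e12 /eqP defL]]] := Pe _ LP.
  have LA z : z \in L -> z \in A.
    by move=> zL; rewrite -covP; apply/bigcupP; exists L.
  have [t1A t2A] : t1 \in A /\ t2 \in A.
    by split; apply: LA; rewrite defL !inE eqxx ?orbT.
  move: tL; rewrite defL => /set2P[] defT; rewrite defT.
    by exists t2; rewrite -defL t2A e12 LP.
  by exists t1; rewrite setUC -defL t1A eS e12 LP.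
rewrite (bigD1 t') ?t'A //= tP big1 // => t2 /andP[/andP[t2A e2] t2t'].
case: ifP => // t2P; case/eqP: t2t'.
have eqL : [set t; t2] = [set t; t'].
  apply/eqP; apply: contraT => /(trivIsetP trivP _ _ t2P tP) /disjoint_setI0.
  by move=> /setP/(_ t); rewrite !inE eqxx.
have : t2 \in [set t; t'] by rewrite -eqL set22.
by move=> /set2P[] // t2t; move: (neq _ _ e2); rewrite t2t eqxx.
Qed.

(** The recursion [card_matchings_rec] determines the count from the adjacency
relation alone, so it is transported along injections.  This is what compares
tilings of different regions, which live in different finite types. *)
Lemma card_matchings_imset (T T' : finType) (e : rel T) (e' : rel T')
    (f : T -> T') (A : {set T}) :
    irreflexive e -> symmetric e -> irreflexive e' -> symmetric e' ->
    {in A &, injective f} -> {in A &, forall t t', e' (f t) (f t') = e t t'} ->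
  #|matchings e' (f @: A)| = #|matchings e A|.
Proof.
move=> eI eS e'I e'S; have [n] := ubnP #|A|.
elim: n A => // n IHn A ltAn finj fe.
have [->|[t tA]] := set_0Vmem A; first by rewrite imset0 !card_matchings0.
rewrite (card_matchings_rec _ _ tA) // (card_matchings_rec _ _ (imset_f f tA)) //.
rewrite (eq_bigl (fun t' => (t' \in f @: A) && e' (f t) t')) //.
rewrite big_mkcondr big_imset //= -big_mkcondr /=.
apply: eq_big => [t'|t' /andP[t'A _]].
  by case t'A: (t' \in A); rewrite //= fe.
have sub : A :\: [set t; t'] \subset A by apply: subsetDl.
have sub' z : z \in A :\: [set t; t'] -> z \in A by apply/subsetP.
rewrite -(IHn (A :\: [set t; t'])); first last.
- by move=> z z' /sub' ? /sub' ?; apply: fe.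
- by move=> z z' /sub' ? /sub' ?; apply: finj.
- apply: leq_trans (ltAn : (_ <= n)%N); apply/proper_card/properP; split=> //.
  by exists t; rewrite // !inE eqxx.
suff -> : f @: A :\: [set f t; f t'] = f @: (A :\: [set t; t']) by [].
apply/setP => z; apply/idP/imsetP.
  rewrite !inE negb_or => /andP[/andP[zt zt'] /imsetP[w wA defz]].
  exists w => //; rewrite !inE wA andbT negb_or.
  by apply/andP; split; [apply: contraNneq zt|apply: contraNneq zt'] => <-; rewrite defz.
move=> [w]; rewrite !inE negb_or => /andP[/andP[wt wt'] wA] ->.
rewrite imset_f // andbT negb_or.
by apply/andP; split; [apply: contraNneq wt|apply: contraNneq wt'] => /finj ->.
Qed.

(** * Neighbouring triangles and the recursion for M *)

(** For an up-pointing triangle the last neighbour is the one below it, for a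
down-pointing one the one above it; the other two lie in the same row. *)
Definition nbrs (t : triangle) : seq triangle :=
  let: (a, b, up) := t in
  if up then [:: (a, b, false); (a - 1, b, false); (a, b - 1, false)]
  else [:: (a, b, true); (a + 1, b, true); (a, b + 1, true)].

Lemma nbrs_uniq t : uniq (nbrs t).
Proof. by case: t => [[a b] []] /=; rewrite !inE !xpair_eqE; lia. Qed.

Lemma card_fsetI3 (p q r : point) (B : {fset point}) :
  uniq [:: p; q; r] ->
  #|` [fset p; q; r] `&` B| = ((p \in B) + (q \in B) + (r \in B))%N.
Proof.
rewrite /= !inE negb_or andbT => /andP[/andP[pq pr] qr].
set C := _ `&` B.
have -> : #|` C| = ((p \in C) + ((q \in C `\ p) + ((r \in C `\ p `\ q) + 0)))%N.
  rewrite (cardfsD1 p) (cardfsD1 q) (cardfsD1 r) (_ : _ `\ r = fset0) ?cardfs0 //.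
  apply/fsetP => z; rewrite !inE.
  by case: (z == p); case: (z == q); case: (z == r).
rewrite !inE !eqxx (eq_sym q p) (negPf pq) (eq_sym r p) (negPf pr) (eq_sym r q).
by rewrite (negPf qr) /= addn0 addnA.
Qed.

Lemma share_edgeE t t' : share_edge t t' = (t' \in nbrs t).
Proof.
have shift (z w : int) :
    [/\ (z + 1 == w + 1) = (w == z), (z + 1 == w) = (w == z + 1),
        (z == w + 1) = (w == z - 1), (z == w) = (w == z)
      & ~~ [|| (w == z) && (w == z + 1), (w == z) && (w == z - 1)
             | (w == z + 1) && (w == z - 1)]].
  by split; lia.
rewrite /share_edge; case: t t' => [[a b] o] [[c d] o'].
have [a1 a2 a3 a4 a5] := shift a c; have [b1 b2 b3 b4 b5] := shift b d.
have upU : uniq [:: (a, b); (a + 1, b); (a, b + 1)].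
  by rewrite /= !inE !xpair_eqE; lia.
have downU : uniq [:: (a, b + 1); (a + 1, b + 1); (a + 1, b)].
  by rewrite /= !inE !xpair_eqE; lia.
case: o; case: o' => /=; rewrite card_fsetI3 //.
all: rewrite !inE !xpair_eqE /= ?(a1, a2, a3, a4, b1, b2, b3, b4).
all: move: a5 b5.
all: case: (c == a); case: (c == a + 1); case: (c == a - 1) => //= _.
all: by case: (d == b); case: (d == b + 1); case: (d == b - 1).
Qed.

Lemma share_edge_irr : irreflexive share_edge.
Proof.
by move=> t; rewrite share_edgeE; case: t => [[a b] []] /=; rewrite !inE !xpair_eqE; lia.
Qed.

Lemma share_edge_sym : symmetric share_edge.
Proof. by move=> t t'; rewrite /share_edge fsetIC. Qed.

(** Common source of [M_iso] and [M_rec]: the tilings of a region got from R by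
deleting triangles or by moving it are counted inside R itself. *)
Lemma M_matchings (R R' : {fset triangle}) (f : triangle -> triangle) (A : {set R}) :
    {in R &, injective f} ->
    {in R &, forall t t', share_edge (f t) (f t') = share_edge t t'} ->
    R' = [fset f (val t) | t in A] ->
  #|matchings (fun t t' : R => share_edge (val t) (val t')) A| = M R'.
Proof.
move=> finj fe ->; set R1 := [fset _ | _ in _].
pose S := f @` R.
have inS (t : R) : f (val t) \in S by apply: in_imfset; apply: valP.
have R1S : R1 `<=` S.
  by apply/fsubsetP => z /imfsetP[t /= tA ->]; apply: inS.
pose g (t : R) : S := [` inS t].
pose h : R1 -> S := fincl R1S.
have eqgh : g @: A = h @: [set: R1].
  apply/setP => z; apply/imsetP/imsetP => [[t tA ->]|[t _ ->]].
    have tR1 : f (val t) \in R1 by apply: in_imfset.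
    by exists [` tR1] => //; apply: val_inj.
  have /imfsetP[w /= wA defz] := valP t.
  by exists w => //; apply: val_inj.
pose share (B : {fset triangle}) (t t' : B) := share_edge (val t) (val t').
have shareI B : irreflexive (share B) by move=> t; apply: share_edge_irr.
have shareS B : symmetric (share B) by move=> t t'; apply: share_edge_sym.
transitivity #|matchings (share S) (g @: A)|.
  symmetry; apply: (card_matchings_imset (e := share R) (e' := share S)).
  - exact: shareI.
  - exact: shareS.
  - exact: shareI.
  - exact: shareS.
  - move=> t t' _ _ /(congr1 val) /= /finj E; apply: val_inj.
    by apply: E; apply: valP.
  - by move=> t t' _ _; rewrite /share /= fe //; apply: valP.
rewrite eqgh; apply: (card_matchings_imset (e := share R1) (e' := share S)).
- exact: shareI.
- exact: shareS.
- exact: shareI.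
- exact: shareS.
- by move=> t t' _ _; apply: fincl_inj.
- by [].
Qed.

Lemma M_iso (R R' : {fset triangle}) (f : triangle -> triangle) :
    {in R &, injective f} ->
    {in R &, forall t t', share_edge (f t) (f t') = share_edge t t'} ->
    R' = f @` R -> M R' = M R.
Proof.
move=> finj fe ->; rewrite -(@M_matchings R (f @` R) f [set: R]) //.
apply/fsetP => z; apply/imfsetP/imfsetP => /= -[t tR ->].
  by exists [` tR]; rewrite ?inE.
by exists (val t) => //; apply: valP.
Qed.

(** All exact enumeration below rests on this recursion: t is covered together
with one of its at most three remaining neighbours. *)
Lemma M_rec (R : {fset triangle}) t : t \in R ->
  M R = (\sum_(v <- nbrs t | v \in R) M (R `\ t `\ v))%N.
Proof.
move=> tR; rewrite [LHS](@card_matchings_rec _ _ setT [` tR]); first last.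
- by rewrite inE.
- by move=> v v'; rewrite share_edge_sym.
- by move=> v; rewrite share_edge_irr.
transitivity (\sum_(v : R | val v \in nbrs t) M (R `\ t `\ val v))%N.
  apply: eq_big => [v|v _]; first by rewrite inE /= share_edgeE.
  apply: (@M_matchings R _ id) => //.
  apply/fsetP => z; rewrite !inE; apply/idP/imfsetP => [/and3P[zv zt zR]|].
    by exists [` zR] => //; rewrite !inE negb_or -!val_eqE zt zv.
  move=> [w /=]; rewrite !inE negb_or -!val_eqE /= => /andP[/andP[wt wv] _] ->.
  by rewrite wt wv; apply: fsvalP.
transitivity (\sum_(v <- R | v \in nbrs t) M (R `\ t `\ v))%N.
  symmetry; exact: (big_seq_fsetE _ R (fun v => v \in nbrs t) (fun v => M (R `\ t `\ v))).
rewrite -big_filter -[in RHS]big_filter; apply: perm_big.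
apply: uniq_perm; rewrite ?filter_uniq ?nbrs_uniq ?fset_uniq //.
by move=> v; rewrite !mem_filter andbC.
Qed.

Lemma M_fset0 : M fset0 = 1%N.
Proof.
transitivity #|matchings (fun t t' : (fset0 : {fset triangle}) =>
                            share_edge (val t) (val t')) setT| => //.
by rewrite (_ : setT = set0) ?card_matchings0 //; apply/setP => -[].
Qed.

(** * Cutting a region in two *)

(** Record the set X of the k for which the edge p k -- q k between A and B is
used as a lozenge: what is left of A and of B is tiled independently.  The
proof is by induction on A: covering one triangle t of A either stays inside A
or uses the edge at t, according to whether t is not, or is, of the form p k
with k in X. *)
Lemma M_split (K : finType) (p q : K -> triangle) (A B : {fset triangle}) :
    injective p -> injective q -> (forall k, share_edge (p k) (q k)) ->
    {in A, forall t, t \notin B} ->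
    {in A & B, forall t v, share_edge t v -> exists k, t = p k /\ v = q k} ->
  M (A `|` B) =
  (\sum_(X : {set K} | [forall k in X, (p k \in A) && (q k \in B)])
     M (A `\` [fset p k | k in X]) * M (B `\` [fset q k | k in X]))%N.
Proof.
move=> pI qI epq.
have [n] := ubnP #|` A|; elim: n A B => // n IHn A B ltAn disj cross.
have mem_im (r : K -> triangle) (X : {set K}) k :
    injective r -> (r k \in [fset r k' | k' in X]) = (k \in X).
  move=> rI; apply/imfsetP/idP => [[k' /= k'X /rI ->] //|kX].
  by exists k.
have [->|[t tA]] := fset_0Vmem A.
  rewrite (bigD1 set0) /=; last by apply/forall_inP => k; rewrite inE.
  rewrite big1 ?addn0 => [|X /andP[/forall_inP vX /set0Pn[k kX]]]; last first.
    by have := vX _ kX.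
  rewrite fset0U fset0D M_fset0 mul1n; congr M.
  apply/fsetP => z; rewrite !inE; case: imfsetP => // -[k /=].
  by rewrite inE.
have tB := disj _ tA.
rewrite (@M_rec _ t) ?inE ?tA //.
rewrite (bigID (fun v => v \in A)) /=.
rewrite [RHS](bigID (fun X : {set K} => t \notin [fset p k | k in X])) /=.
(* Lozenges at t inside A correspond to the X that do not involve t. *)
congr (_ + _)%N.
  transitivity (\sum_(v <- nbrs t | v \in A)
     \sum_(X : {set K} | [forall k in X, (p k \in A `\ t `\ v) && (q k \in B)])
     M (A `\ t `\ v `\` [fset p k | k in X]) * M (B `\` [fset q k | k in X]))%N.
    apply: eq_big => [v|v /andP[_ vA]].
      by rewrite inE; case: (v \in A) => /=; rewrite ?andbF ?andbT ?orbT.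
    have vB := disj _ vA.
    rewrite (_ : _ `\ v = A `\ t `\ v `|` B); last first.
      apply/fsetP => z; rewrite !inE; case zB : (z \in B) => /=; last by rewrite !orbF.
      rewrite !orbT !andbT; apply/andP; split.
        by apply: contraNneq vB => <-.
      by apply: contraNneq tB => <-.
    apply: IHn.
    - apply: leq_trans (ltAn : (_ <= n)%N); apply: leq_ltn_trans (_ : #|` A `\ t| < _)%N.
        by apply: fsubset_leq_card; apply: fsubsetDl.
      by rewrite (cardfsD1 t A) tA.
    - by move=> z; rewrite !inE => /and3P[_ _ /disj].
    - by move=> z w; rewrite !inE => /and3P[_ _ zA] wB; apply: cross.
  rewrite (exchange_big_dep (fun X : {set K} => [forall k in X, (p k \in A) && (q k \in B)] &&
     (t \notin [fset p k | k in X]))) /=; last first.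
    move=> v X vA /forall_inP vX; apply/andP; split.
      by apply/forall_inP => k /vX; rewrite !inE => /andP[/and3P[_ _ ->] ->].
    apply/imfsetP => -[k /= /vX]; rewrite !inE => /andP[/and3P[_ kt _] _] tk.
    by rewrite tk eqxx in kt.
  apply: eq_bigr => X /andP[/forall_inP vX tX].
  rewrite [in RHS](@M_rec _ t) ?inE ?tA ?andbT // big_distrl /=.
  apply: eq_big => [v|v _].
    rewrite !inE andbC; case vA: (v \in A); rewrite ?andbF ?andbT //= ?andbT.
    apply/forall_inP/negP => [H /imfsetP[k /= kX vk]|H k kX].
      by have := H k kX; rewrite !inE vk eqxx.
    have /andP[pkA ->] := vX _ kX.
    rewrite !inE pkA !andbT; apply/andP; split.
      by apply/eqP => pkv; apply: H; apply/imfsetP; exists k.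
    by apply: contraNneq tX => <-; rewrite mem_im.
  congr (_ * _)%N; congr M; apply/fsetP => z; rewrite !inE.
  by case: (z \in A); rewrite ?andbF ?andbT // andbC andbA.
transitivity (\sum_(v <- nbrs t | v \in B)
     \sum_(X : {set K} | [forall k in X, (p k \in A `\ t) && (q k \in B `\ v)])
     M (A `\ t `\` [fset p k | k in X]) * M (B `\ v `\` [fset q k | k in X]))%N.
  apply: eq_big => [v|v /andP[+ vA]].
    by rewrite inE; case vA: (v \in A); rewrite ?andbF ?andbT //= (negPf (disj _ vA)).
  rewrite inE (negPf vA) /= => vB.
  rewrite (_ : _ `\ v = A `\ t `|` (B `\ v)); last first.
    apply/fsetP => z; rewrite !inE; case zA : (z \in A) => /=.
      rewrite (negPf (disj _ zA)) !andbF !orbF !andbT andb_idl // => _.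
      by apply: contraNneq vA => <-.
    case zB : (z \in B); rewrite ?(andbF, andbT, orbF, orbT) //= andb_idr // => _.
    by apply: contraNneq tB => <-.
  apply: IHn.
  - by apply: leq_trans (ltAn : (_ <= n)%N); rewrite (cardfsD1 t A) tA.
  - by move=> z; rewrite !inE negb_and => /andP[_ /disj ->]; rewrite orbT.
  - by move=> z w; rewrite !inE => /andP[_ zA] /andP[_ wB]; apply: cross.
(* At most one k has p k = t; if there is one, X is k together with a set for
   the regions deprived of p k and q k. *)
have [/existsP[k /andP[/eqP pk qkB]]|nok] := boolP [exists k, (p k == t) && (q k \in B)].
  have nbk v : v \in nbrs t -> v \in B -> v = q k.
    rewrite -share_edgeE => tv vB; have [k' [tk ->]] := cross _ _ tA vB tv.
    by congr q; apply: pI; rewrite -tk.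
  rewrite -big_filter (_ : [seq v <- _ | _] = [:: q k]); last first.
    apply: perm_small_eq => //; apply: uniq_perm; rewrite ?filter_uniq ?nbrs_uniq //.
    move=> v; rewrite mem_filter inE; apply/andP/eqP => [[vB /nbk ->] //|->].
    by rewrite qkB -share_edgeE -pk.
  rewrite big_seq1 [RHS](reindex_onto (fun X => k |: X) (fun X => X :\ k)) /=; last first.
    move=> X /andP[_]; rewrite negbK -pk mem_im // => kX; exact: setD1K.
  have eqk X : ((k |: X) :\ k == X) = (k \notin X).
    apply/eqP/idP => [<-|]; last exact: setU1K.
    by rewrite !inE eqxx.
  apply: eq_big => [X|X _].
    rewrite negbK -pk mem_im // setU11 andbT eqk.
    apply/forall_inP/andP => [H|[/forall_inP H kX] k' k'X].
      split; last by apply/negP => /H; rewrite !inE eqxx.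
      apply/forall_inP => k' /setU1P[->|/H]; first by rewrite pk tA qkB.
      by rewrite !inE => /andP[/andP[_ ->] /andP[_ ->]].
    have k'k : k' != k by apply: contraNneq kX => <-.
    have := H k'; rewrite !inE k'X orbT => /(_ isT) /andP[-> ->].
    by rewrite !(inj_eq pI, inj_eq qI) k'k.
  have im (r : K -> triangle) (X' : {set K}) (C : {fset triangle}) :
      C `\ r k `\` [fset r k' | k' in X'] = C `\` [fset r k' | k' in k |: X'].
    apply/fsetP => z; rewrite !inE; case: (z \in C); rewrite ?andbF // !andbT.
    rewrite -negb_or; congr (~~ _); apply/orP/imfsetP => /= [[/imfsetP[k' /= k'X ->]|/eqP ->]|].
    - by exists k' => //; rewrite inE k'X orbT.
    - by exists k => //; rewrite setU11.
    by move=> [k' /setU1P[->|k'X] ->]; [right|left; apply/imfsetP; exists k'].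
  by rewrite -pk !im.
rewrite [LHS]big1_seq => [|v /andP[vB]]; last first.
  rewrite -share_edgeE => tv; have [k [tk vk]] := cross _ _ tA vB tv.
  by case/existsP: nok; exists k; rewrite -tk -vk vB eqxx.
rewrite big1 // => X /andP[/forall_inP vX]; rewrite negbK => /imfsetP[k /= kX tk].
by case/existsP: nok; exists k; rewrite -tk eqxx; have /andP[_ ->] := vX _ kX.
Qed.

(** * Peeling a row off a dented trapezoid *)

(** The rows c of the trapezoid are b, ..., b + h - 1, and row b has base w.  In
row b the triangles up(0), down(0), up(1), down(1), ... form a path; numbering
them 0, 1, 2, 3, ..., only those numbered at least k are kept, so that row b can
be used up from left to right.  S lists the dents of row b, and X those already
made in row b + 1 by vertical lozenges coming from row b. *)
Definition trapezoid_cond (b : int) (w h k : nat) (S X : seq nat) (t : triangle) : bool :=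
  let: (a, c, up) := t in
  [&& 0 <= a, b <= c < b + h%:Z, a + (c - b) + (if up then 1 else 2) <= w%:Z,
      (c == b) ==> (k%:Z <= 2 * a + (if up then 0 else 1)),
      (c == b) && up ==> (`|a|%N \notin S)
    & (c == b + 1) && up ==> (`|a|%N \notin X)].

Definition trapezoid (b : int) (w h k : nat) (S X : seq nat) : {fset triangle} :=
  [fset t in [seq ((v.1.1 : nat)%:Z, b + (v.1.2 : nat)%:Z, v.2)
                | v : 'I_w * 'I_h * bool]
   | trapezoid_cond b w h k S X t].

Lemma in_trapezoid b w h k S X t :
  (t \in trapezoid b w h k S X) = trapezoid_cond b w h k S X t.
Proof.
rewrite !inE /=; case Ht : trapezoid_cond; rewrite ?andbF ?andbT //.
case: t Ht => [[a c] o] /and5P[a0 /andP[bc cb] acw _ _].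
have wa : (`|a|%N < w)%N by case: o acw; lia.
have hc : (`|c - b|%N < h)%N by lia.
apply/mapP; exists (Ordinal wa, Ordinal hc, o); first by rewrite mem_enum.
by congr (_, _, _) => /=; lia.
Qed.

Section Strip.
Variables (b : int) (w h : nat).
Hypothesis h_gt0 : (0 < h)%N.
Implicit Types (a c k : nat) (S X : seq nat).

Local Notation W := (trapezoid b w h).

(** The first remaining triangle of the row, if up-pointing, has its right
neighbour as its only partner. *)
Lemma trapezoid_up a S X : (a < w)%N -> a \notin S ->
  M (W a.*2 S X) = if (a.+1 < w)%N then M (W a.+1.*2 S X) else 0%N.
Proof.
move=> aw aS; rewrite (@M_rec _ (a%:Z, b, true)); last first.
  by rewrite in_trapezoid /= aS; lia.
have -> : nbrs (a%:Z, b, true) =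
  [:: (a%:Z, b, false); (a%:Z - 1, b, false); (a%:Z, b - 1, false)] by [].
rewrite big_mkcond !big_cons big_nil.
rewrite (_ : ((a%:Z, b, false) \in _) = (a.+1 < w)%N); last first.
  by rewrite in_trapezoid /=; lia.
rewrite (_ : ((a%:Z - 1, b, false) \in _) = false); last first.
  by rewrite in_trapezoid /=; lia.
rewrite (_ : ((a%:Z, b - 1, false) \in _) = false); last first.
  by rewrite in_trapezoid /=; lia.
rewrite /= !addn0; case: ifP => // a1w; congr M; apply/fsetP => -[[z c] o].
rewrite !in_fsetD1 !in_trapezoid /= !xpair_eqE; case: o; lia.
Qed.

(** The first remaining triangle of the row, if down-pointing, is covered
together with its right neighbour or by a vertical lozenge, which makes a dent
at a in the next row. *)
Lemma trapezoid_down a S X : (a.+1 < w)%N ->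
  M (W a.*2.+1 S X) =
  ((if a.+1 \in S then 0 else M (W a.+1.*2.+1 S X)) +
   (if (1 < h)%N && (a \notin X) then M (W a.+1.*2 S (a :: X)) else 0))%N.
Proof.
move=> aw; rewrite (@M_rec _ (a%:Z, b, false)); last first.
  by rewrite in_trapezoid /=; lia.
have -> : nbrs (a%:Z, b, false) =
  [:: (a%:Z, b, true); (a%:Z + 1, b, true); (a%:Z, b + 1, true)] by [].
rewrite big_mkcond !big_cons big_nil.
rewrite (_ : ((a%:Z, b, true) \in _) = false); last first.
  by rewrite in_trapezoid /=; lia.
have a1 : absz (a%:Z + 1) = a.+1 by lia.
rewrite (_ : ((a%:Z + 1, b, true) \in _) = (a.+1 \notin S)); last first.
  by rewrite in_trapezoid /trapezoid_cond a1; lia.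
rewrite (_ : ((a%:Z, b + 1, true) \in _) = (1 < h)%N && (a \notin X)); last first.
  by rewrite in_trapezoid /=; lia.
rewrite /= add0n addn0 if_neg.
congr (_ + _)%N.
  case: ifP => // a1S; congr M; apply/fsetP => -[[z c] o].
  by rewrite !in_fsetD1 !in_trapezoid /= !xpair_eqE; case: o; lia.
case: ifP => // /andP[h1 aX]; congr M; apply/fsetP => -[[z c] o].
rewrite !in_fsetD1 !in_trapezoid /= !xpair_eqE in_cons; case: o; last by lia.
have [z0|] := boolP (0 <= z); last by rewrite /= !andbF.
rewrite (_ : (absz z == a) = (z == a%:Z)); last by lia.
case: (absz z \in S); case: (absz z \in X); lia.
Qed.

(** The forced lozenges run up to the last triangle of the row, which is
up-pointing and stays alone. *)
Lemma trapezoid_up_stuck a S X : (a < w)%N ->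
  (forall p, (a <= p < w)%N -> p \notin S) -> M (W a.*2 S X) = 0%N.
Proof.
have [n] := ubnP (w - a); elim: n a => // n IHn a lan aw noS.
rewrite trapezoid_up ?noS ?leqnn //; case: ifP => // a1w.
by apply: IHn => // [|p pw]; [lia | apply: noS; lia].
Qed.

(** The forced lozenges run up to the next dent c. *)
Lemma trapezoid_up_forced a c S X : (a <= c < w)%N -> c \in S ->
  (forall p, (a <= p < c)%N -> p \notin S) -> M (W a.*2 S X) = M (W c.*2.+1 S X).
Proof.
have [n] := ubnP (c - a); elim: n a => // n IHn a lan /andP[ac cw] cS noS.
have [ac'|ac'] := eqVneq a c.
  congr M; apply/fsetP => -[[z d] o]; rewrite !in_trapezoid /=.
  have [->|] := eqVneq z a%:Z; last by case: o; lia.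
  by rewrite /= ac' cS; case: o; lia.
rewrite trapezoid_up ?noS; try lia; rewrite ifT; last by lia.
by apply: IHn => // [||p pw]; [lia | lia | apply: noS; lia].
Qed.

Lemma trapezoid_top S X : (0 < w)%N ->
  trapezoid b w h w.-1.*2.+1 S X = trapezoid (b + 1) w.-1 h.-1 0 X [::].
Proof.
move=> w_gt0; apply/fsetP => -[[z d] o]; rewrite !in_trapezoid /=.
by case: o; lia.
Qed.

(** After the last dent no vertical lozenge can be used, by
[trapezoid_up_stuck]: the rest of the row is forced. *)
Lemma trapezoid_down_free a S X : (a < w)%N ->
  (forall p, (a < p < w)%N -> p \notin S) ->
  M (W a.*2.+1 S X) = M (trapezoid (b + 1) w.-1 h.-1 0 X [::]).
Proof.
have [n] := ubnP (w - a); elim: n a => // n IHn a lan aw noS.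
have [a1w|a1w] := ltnP a.+1 w; last first.
  have -> : a = w.-1 by lia.
  by rewrite trapezoid_top //; lia.
rewrite trapezoid_down // ifN ?noS ?ltnSn // trapezoid_up_stuck //.
by rewrite if_same addn0; apply: IHn => // [|p pw]; [lia | apply: noS; lia].
Qed.

(** Between two successive dents a and c exactly one vertical lozenge is used,
at some x with a <= x < c; this is the interlacing condition. *)
Lemma trapezoid_down_between a c S X : (1 < h)%N -> (a < c < w)%N -> c \in S ->
  (forall p, (a < p < c)%N -> p \notin S) -> (forall p, (a <= p < c)%N -> p \notin X) ->
  M (W a.*2.+1 S X) = (\sum_(a <= x < c) M (W c.*2.+1 S (x :: X)))%N.
Proof.
move=> h1; have [n] := ubnP (c - a); elim: n a => // n IHn a lan /andP[ac cw] cS noS noX.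
rewrite trapezoid_down ?h1 ?noX ?leqnn //=; last by lia.
rewrite big_ltn // addnC; congr (_ + _)%N.
  by apply: trapezoid_up_forced => //; lia.
have [a1c|a1c] := eqVneq a.+1 c; first by rewrite a1c cS big_geq.
rewrite ifN; last by apply: noS; lia.
by apply: IHn => // [||p pw|p pw]; [lia | lia | apply: noS; lia | apply: noX; lia].
Qed.

(** In the top row there are no vertical lozenges, hence there is at most one
dent. *)
Lemma trapezoid_down_stuck a c S X : h = 1%N -> (a < c < w)%N -> c \in S ->
  M (W a.*2.+1 S X) = 0%N.
Proof.
move=> h1; have [n] := ubnP (c - a); elim: n a => // n IHn a lan /andP[ac cw] cS.
rewrite trapezoid_down; last by lia.
have -> : (1 < h)%N = false by rewrite h1.
rewrite addn0; case: ifP => // a1S.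
have a1c : a.+1 != c by apply: contraFneq a1S => ->.
by apply: IHn => //; lia.
Qed.
End Strip.

(** The sequences X summed over are those interlacing with a :: s.  The recursion
on s follows the peeling of a row from left to right, one interval between
successive dents at a time. *)
Fixpoint interlacing_sum (a : nat) (s : seq nat) (G : seq nat -> rat) : rat :=
  if s is c :: s' then
    \sum_(a <= x < c) interlacing_sum c s' (fun X => G (x :: X))
  else G [::].

Lemma eq_interlacing_sum a s G G' :
  G =1 G' -> interlacing_sum a s G = interlacing_sum a s G'.
Proof.
elim: s a G G' => //= c s IHs a G G' eqG.
by apply: eq_bigr => x _; apply: IHs => X; apply: eqG.
Qed.

Lemma eq_trapezoid b w h k S S' X X' : S =i S' -> X =i X' ->
  trapezoid b w h k S X = trapezoid b w h k S' X'.
Proof.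
by move=> eqS eqX; apply/fsetP => -[[z d] o]; rewrite !in_trapezoid /= eqS eqX.
Qed.

(** The alternative in the second hypothesis excludes the case in which a
vertical lozenge is required but there is no row above. *)
Lemma trapezoid_down_peel b w h a s S X :
    (0 < h)%N -> (1 < h)%N || nilp s -> (a < w)%N -> path ltn a s -> all (ltn^~ w) s ->
    (forall p, (a < p < w)%N -> (p \in S) = (p \in s)) -> all (ltn^~ a) X ->
  (M (trapezoid b w h a.*2.+1 S X))%:R =
  interlacing_sum a s
    (fun X' => (M (trapezoid (b + 1) w.-1 h.-1 0 (X ++ X') [::]))%:R).
Proof.
move=> h0; elim: s a X => [|c s IHs] a X /= h1 aw.
  by move=> _ _ Ss _; rewrite cats0 trapezoid_down_free // => p pw; rewrite Ss.
move=> /andP[ac cs] /andP[cw sw] Ss Xa; rewrite orbF in h1.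
have cS : c \in S by rewrite Ss ?mem_head // ac.
have c_lt z : z \in s -> (c < z)%N.
  by apply/allP; apply: order_path_min cs => ? ? ?; apply: ltn_trans.
rewrite (@trapezoid_down_between _ _ _ h0 a c) ?ac ?cw //; first last.
- by move=> p pw; apply/negP => /(allP Xa); lia.
- move=> p pw; rewrite Ss; last by lia.
  by rewrite in_cons negb_or; apply/andP; split; [lia | apply/negP => /c_lt; lia].
rewrite natr_sum; apply: eq_big_nat => x /andP[ax xc].
rewrite IHs ?h1 //; first last.
- by rewrite /= xc; apply/allP => z /(allP Xa); lia.
- move=> p pw; rewrite Ss; last by lia.
  by rewrite in_cons (_ : p == c = false) //; lia.
apply: eq_interlacing_sum => X'; congr (_%:R); congr M.
by apply: eq_trapezoid => // z; rewrite !(in_cons, mem_cat) orbCA.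
Qed.

Lemma trapezoid_peel b w h s S :
    (1 < h)%N || (size s <= 1)%N -> (0 < h)%N ->
    sorted ltn s -> all (ltn^~ w) s -> S =i s -> s != [::] ->
  (M (trapezoid b w h 0 S [::]))%:R =
  interlacing_sum (head 0%N s) (behead s)
    (fun X => (M (trapezoid (b + 1) w.-1 h.-1 0 X [::]))%:R).
Proof.
case: s => //= a s h1 h0 as_ /andP[aw sw] Ss _.
have a_lt z : z \in s -> (a < z)%N.
  by apply/allP; apply: order_path_min as_ => ? ? ?; apply: ltn_trans.
rewrite -[X in trapezoid _ _ _ X]double0 (@trapezoid_up_forced _ _ _ h0 0 a) //; first last.
- by move=> p pa; rewrite Ss in_cons negb_or; apply/andP; split; [lia|apply/negP => /a_lt; lia].
- by rewrite Ss mem_head.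
rewrite (@trapezoid_down_peel _ _ _ _ s) //.
  by case: (s) h1 => //=; lia.
move=> p pw; rewrite Ss in_cons (_ : p == a = false) //; lia.
Qed.

(** * The Cohn-Larsen-Propp product formula *)

(** The sequences summed over are again strictly increasing and bounded, so they
are legitimate sets of dents. *)
Lemma eq_in_interlacing_sum w a s G G' : path ltn a s -> all (leq^~ w) s ->
    (forall X, size X = size s -> sorted ltn X -> all (leq a) X ->
       all (ltn^~ w) X -> G X = G' X) ->
  interlacing_sum a s G = interlacing_sum a s G'.
Proof.
elim: s a G G' => [|c s IHs] a G G' /=; first by move=> _ _; apply.
move=> /andP[ac cs] /andP[cw sw] eqG; apply: eq_big_nat => x /andP[ax xc].
apply: IHs => // X szX sX cX Xw; apply: eqG; rewrite /= ?szX ?ax ?Xw ?andbT //.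
- rewrite path_sortedE ?sX ?andbT; last by move=> ? ? ?; apply: ltn_trans.
  by apply/allP => z /(allP cX); apply: leq_trans.
- by apply/allP => z /(allP cX); lia.
by lia.
Qed.

Lemma interlacing_sum_sum (I : finType) a s (G : I -> seq nat -> rat) :
  interlacing_sum a s (fun X => \sum_i G i X) = \sum_i interlacing_sum a s (G i).
Proof.
elim: s a G => //= c s IHs a G; rewrite exchange_big /=.
by apply: eq_bigr => x _; rewrite -IHs.
Qed.

Lemma interlacing_sumZ a s k G :
  interlacing_sum a s (fun X => k * G X) = k * interlacing_sum a s G.
Proof.
elim: s a G => //= c s IHs a G; rewrite mulr_sumr.
by apply: eq_bigr => x _; rewrite -IHs.
Qed.

(** The intervals of the different entries of X are independent. *)
Lemma interlacing_sum_prod a s (F : 'I_(size s) -> nat -> rat) :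
  interlacing_sum a s (fun X => \prod_(i < size s) F i (nth 0%N X i)) =
  \prod_(i < size s) \sum_(nth 0%N (a :: s) i <= x < nth 0%N s i) F i x.
Proof.
elim: s a F => [|c s IHs] a F /=; first by rewrite !big_ord0.
rewrite big_ord_recl /= -(IHs c (fun i => F (lift ord0 i))) mulr_suml.
apply: eq_bigr => x _; rewrite -interlacing_sumZ.
by apply: eq_interlacing_sum => X; rewrite big_ord_recl.
Qed.

Definition binom_det (n : nat) (s : seq nat) : rat :=
  \det (\matrix_(i < n, j < n) ('C(nth 0%N s i, j))%:R).

Lemma sum_binom (a c j : nat) : (a <= c)%N ->
  \sum_(a <= x < c) ('C(x, j))%:R = ('C(c, j.+1))%:R - ('C(a, j.+1))%:R :> rat.
Proof.
move=> ac; rewrite -(telescope_sumr (fun x => ('C(x, j.+1))%:R : rat) ac).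
by apply: eq_bigr => x _; rewrite binS natrD addrAC subrr add0r.
Qed.

(** Subtract from each row the preceding one, then expand along the first
column, in which all binomial coefficients are 'C(_, 0) = 1.  The subtraction
is multiplication by the bidiagonal matrix L. *)
Lemma binom_det_cons a s :
  binom_det (size s).+1 (a :: s) =
  \det (\matrix_(i < size s, j < size s)
     (('C(nth 0%N s i, j.+1))%:R - ('C(nth 0%N (a :: s) i, j.+1))%:R) : 'M[rat]_(size s)).
Proof.
set n := size s; rewrite /binom_det; set A := \matrix_(_, _) _.
pose L : 'M[rat]_n.+1 := \matrix_(i, j) ((i == j)%:R - (i == j.+1 :> nat)%:R).
have detL : \det L = 1.
  rewrite det_trig; last first.
    apply/is_trig_mxP => i j ij; rewrite mxE -val_eqE /= !ltn_eqF ?subrr //; lia.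
  by rewrite big1 // => i _; rewrite mxE eqxx (ltn_eqF (ltnSn i)) mulr0n subr0.
transitivity (\det (L *m A)); first by rewrite det_mulmx detL mul1r.
have LA0 j : (L *m A) ord0 j = A ord0 j.
  rewrite mxE (bigD1 ord0) //= big1 ?mxE ?addr0.
    by rewrite eqxx mul1r.
  by move=> k k0; rewrite !mxE eq_sym (negPf k0) ?mulr0n ?subr0 mul0r.
have LAS (i : 'I_n) j : (L *m A) (lift ord0 i) j
    = A (lift ord0 i) j - A (widen_ord (leqnSn n) i) j.
  rewrite mxE; under eq_bigr => k _ do rewrite mxE mulrBl.
  rewrite big_split /= sumrN; congr (_ - _).
    rewrite (bigD1 (lift ord0 i)) //= eqxx mul1r big1 ?addr0 // => k ki.
    by rewrite eq_sym (negPf ki) mul0r.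
  rewrite (bigD1 (widen_ord (leqnSn n) i)) //= eqxx mul1r big1 ?addr0 // => k ki.
  rewrite /= /bump leq0n add1n eqSS (_ : (_ == _ :> nat) = false) ?mul0r //.
  by apply: contraNF ki => /eqP ik; apply/eqP/val_inj.
rewrite (expand_det_col _ ord0) big_ord_recl big1 ?addr0.
  rewrite LA0 mxE bin0 mul1r /cofactor addn0 expr0 mul1r; congr (\det _).
  by apply/matrixP => i j; rewrite 2!mxE LAS !mxE !lift0.
by move=> i _; rewrite LAS !mxE !bin0 subrr mul0r.
Qed.

(** The determinant is linear in each row, and row i depends on the i-th entry
of X only; so the summation goes inside, where [sum_binom] evaluates it. *)
Lemma interlacing_sum_binom_det a s : path leq a s ->
  interlacing_sum a s (binom_det (size s)) = binom_det (size s).+1 (a :: s).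
Proof.
move=> as_; rewrite binom_det_cons /determinant interlacing_sum_sum.
apply: eq_bigr => g _; rewrite interlacing_sumZ; congr (_ * _).
pose F (i : 'I_(size s)) x : rat := ('C(x, g i))%:R.
rewrite (@eq_interlacing_sum _ _ _ (fun X => \prod_i F i (nth 0%N X i))); last first.
  by move=> X; apply: eq_bigr => i _; rewrite mxE.
rewrite interlacing_sum_prod; apply: eq_bigr => i _.
rewrite mxE sum_binom //.
by have /pathP := as_; apply.
Qed.

(** Each row uses up exactly one dent, and the top row needs exactly one. *)
Lemma trapezoid_unbalanced h b w s : (0 < h <= w)%N -> sorted ltn s ->
  all (ltn^~ w) s -> size s != h -> M (trapezoid b w h 0 s [::]) = 0%N.
Proof.
elim: h b w s => // h IHh b w [|a s] /= hw as_.
  by move=> _ _; rewrite -double0 trapezoid_up_stuck //; lia.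
move=> /andP[aw sw] sz.
have a_lt z : z \in s -> (a < z)%N.
  by apply/allP; apply: order_path_min as_ => ? ? ?; apply: ltn_trans.
have [h0|h0] := posnP h.
  rewrite {}h0 in sz *; case: s as_ sw a_lt sz => // c s /= /andP[ac _] /andP[cw _] a_lt _.
  rewrite -[X in trapezoid _ _ _ X]double0 (@trapezoid_up_forced _ _ _ _ 0 a) ?mem_head //.
    by rewrite (@trapezoid_down_stuck _ _ _ _ a c) ?ac // in_cons mem_head orbT.
  by move=> p pa; rewrite inE negb_or; apply/andP; split; [lia|apply/negP => /a_lt; lia].
apply/eqP; rewrite -(eqr_nat rat) (@trapezoid_peel _ _ _ (a :: s)) //= ?aw //; last by lia.
rewrite (@eq_in_interlacing_sum w.-1 _ _ _ (fun _ => 0)) //.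
- apply/eqP; elim: (s) (a) => //= c s' IHs a'.
  by rewrite big1.
- by apply/allP => z /(allP sw) /=; lia.
move=> X szX sX _ Xw; rewrite IHh ?szX //; lia.
Qed.

(** The theorem of Cohn, Larsen and Propp on dented trapezoids. *)
Lemma M_trapezoid h b w s : size s = h -> sorted ltn s -> all (ltn^~ w) s ->
  (M (trapezoid b w h 0 s [::]))%:R = binom_det h s.
Proof.
elim: h b w s => [|h IHh] b w s sz.
  move=> _ _; rewrite /binom_det det_mx00 (_ : trapezoid _ _ _ _ _ _ = fset0) ?M_fset0 //.
  by apply/fsetP => -[[z d] o]; rewrite in_trapezoid /= in_fset0; lia.
case: s sz => //= a s [sz] as_ /andP[aw sw].
rewrite (@trapezoid_peel _ _ _ (a :: s)) //= ?aw //; last by lia.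
rewrite (@eq_in_interlacing_sum w.-1 _ _ _ (binom_det (size s))) //.
- rewrite interlacing_sum_binom_det ?sz //.
  by apply: sub_path as_ => x y /ltnW.
- by apply/allP => z /(allP sw) /=; lia.
by move=> X szX sX _ Xw; rewrite sz IHh // szX.
Qed.

(** The coefficient matrix of the polynomials p j is unitriangular. *)
Lemma det_monic_horner n (x : 'I_n -> rat) (p : 'I_n -> {poly rat}) :
    (forall j, p j \is monic) -> (forall j : 'I_n, size (p j) = j.+1) ->
  \det (\matrix_(i, j) (p j).[x i]) = \prod_(i < n) \prod_(j < n | (i < j)%N) (x j - x i).
Proof.
move=> mp szp; pose C : 'M[rat]_n := \matrix_(k, j) (p j)`_k.
have -> : \matrix_(i, j) (p j).[x i] = (Vandermonde n (\row_i x i))^T *m C.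
  apply/matrixP => i j; rewrite !mxE (@horner_coef_wide _ n) ?szp //.
  by apply: eq_bigr => k _; rewrite !mxE mulrC.
rewrite det_mulmx det_tr det_Vandermonde -det_tr det_trig; last first.
  by apply/is_trig_mxP => i j ij; rewrite !mxE nth_default // szp.
rewrite [X in _ * X]big1 ?mulr1; last first.
  by move=> i _; rewrite !mxE; have /monicP := mp i; rewrite /lead_coef szp.
by apply: eq_bigr => i _; apply: eq_bigr => j _; rewrite !mxE.
Qed.

(** j! 'C(X, j) = X (X - 1) ... (X - j + 1) is monic of degree j. *)
Lemma binom_det_Vandermonde n s :
  binom_det n s * \prod_(j < n) (j`!)%:R =
  \prod_(i < n) \prod_(j < n | (i < j)%N) ((nth 0%N s j)%:R - (nth 0%N s i)%:R).
Proof.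
pose p (j : nat) : {poly rat} := \prod_(k < j) ('X - (k%:R)%:P).
have p_eval j x : (p j).[x%:R] = ('C(x, j))%:R * (j`!)%:R.
  rewrite -natrM bin_ffact; elim: j => [|j IHj].
    by rewrite /p big_ord0 hornerC.
  rewrite /p big_ord_recr hornerM IHj ffactnSr natrM !hornerE.
  have [xj|jx] := ltnP x j; first by rewrite ffact_small ?mul0r.
  by rewrite natrB.
rewrite -(@det_monic_horner n (fun i => (nth 0%N s i)%:R) (fun j => p j)).
- rewrite (_ : \matrix_(i, j) _ = (\matrix_(i < n, j < n) ('C(nth 0%N s i, j))%:R)
      *m diag_mx (\row_j (j`!)%:R)).
    by rewrite det_mulmx det_diag; congr (_ * _); apply: eq_bigr => j _; rewrite mxE.
  by apply/matrixP => i j; rewrite mul_mx_diag !mxE p_eval.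
- by move=> j; apply: monic_prod_XsubC.
move=> j; rewrite /p -(big_mkord xpredT (fun k => 'X - (k%:R : rat)%:P)).
by rewrite size_prod_XsubC size_iota subn0.
Qed.

(** * The two halves of the hexagon *)

Definition dents (m : nat) (S : {set 'I_m}) : seq nat := [seq val i | i <- enum S].

Lemma size_dents m (S : {set 'I_m}) : size (dents S) = #|S|.
Proof. by rewrite size_map cardE. Qed.

Lemma mem_dents m (S : {set 'I_m}) (k : 'I_m) : (val k \in dents S) = (k \in S).
Proof. by rewrite mem_map ?mem_enum //; apply: val_inj. Qed.

Lemma dents_lt m (S : {set 'I_m}) : all (ltn^~ m) (dents S).
Proof. by rewrite all_map; apply/allP => i _ /=. Qed.

Lemma dents_sorted m (S : {set 'I_m}) : sorted ltn (dents S).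
Proof.
rewrite /dents /enum_mem -enumT sorted_map.
apply: sorted_filter; first by move=> ? ? ?; apply: ltn_trans.
by rewrite -sorted_map val_enum_ord iota_ltn_sorted.
Qed.

Lemma dentsU m (S Y : {set 'I_m}) k :
  (k \in dents (S :|: Y)) = (k \in dents S) || (k \in dents Y).
Proof.
apply/mapP/orP => [[i]|].
  by rewrite mem_enum inE => /orP[iS ->|iY ->]; [left|right]; rewrite mem_dents.
case=> /mapP[i]; rewrite mem_enum => iS ->; exists i => //; rewrite mem_enum inE iS //.
exact: orbT.
Qed.

Definition Vandermonde_prod (m : nat) (S : {set 'I_m}) : rat :=
  \prod_(i in S) \prod_(j in S | (i < j)%N) (j%:R - i%:R).

Lemma Vandermonde_prod_gt0 m (S : {set 'I_m}) : 0 < Vandermonde_prod S.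
Proof.
by apply: prodr_gt0 => i _; apply: prodr_gt0 => j /andP[_ ij]; rewrite subr_gt0 ltr_nat.
Qed.

Lemma Vandermonde_prod_imset m k (f : 'I_k -> 'I_m) :
    {homo f : i j / (i < j)%N} ->
  Vandermonde_prod [set f i | i : 'I_k] =
  \prod_(i < k) \prod_(j < k | (i < j)%N) ((f j)%:R - (f i)%:R).
Proof.
move=> f_incr.
have f_mono : {mono f : i j / (i < j)%N}.
  move=> i j; case: (ltngtP i j) => [/f_incr -> //|/f_incr|ij]; first lia.
  by rewrite (val_inj ij) ltnn.
have f_inj : injective f.
  move=> i j fij; apply: val_inj; have := f_mono i j; have := f_mono j i.
  by rewrite fij ltnn; case: ltngtP.
rewrite /Vandermonde_prod big_imset /=; last by move=> i j _ _; apply: f_inj.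
apply: eq_bigr => i _; rewrite big_mkcondr big_imset /=; last by move=> ? ? _ _; apply: f_inj.
by rewrite [RHS]big_mkcond; apply: eq_bigr => j _; rewrite f_mono.
Qed.

Lemma binom_det_dents m (S : {set 'I_m}) :
  binom_det #|S| (dents S) * \prod_(j < #|S|) (j`!)%:R = Vandermonde_prod S.
Proof.
rewrite binom_det_Vandermonde.
have nthE (i : 'I_#|S|) : nth 0%N (dents S) i = enum_val i.
  by rewrite (nth_map (enum_val i)) -?cardE // -enum_val_nth.
have ev_incr : {homo @enum_val _ (mem S) : i j / (i < j)%N}.
  move=> i j ij; rewrite -!nthE; apply: (sorted_ltn_nth ltn_trans) => //.
  - exact: dents_sorted.
  - by rewrite inE size_dents.
  by rewrite inE size_dents.
rewrite -[S in RHS](_ : [set enum_val i | i : 'I_#|S|] = S).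
  rewrite (Vandermonde_prod_imset ev_incr).
  by apply: eq_bigr => i _; apply: eq_bigr => j _; rewrite !nthE.
apply/setP => k; apply/imsetP/idP => [[i _ ->]|kS]; first exact: enum_valP.
by exists (enum_rank_in kS k); rewrite ?enum_rankK_in.
Qed.

(** A pair with one element in S and one in Y occurs in exactly one of the two
orders, so it contributes its distance. *)
Lemma Vandermonde_prodU m (S Y : {set 'I_m}) : [disjoint S & Y]%B ->
  Vandermonde_prod (S :|: Y) =
  Vandermonde_prod S * Vandermonde_prod Y *
  \prod_(i in S) \prod_(j in Y) `|j%:R - i%:R|.
Proof.
move=> dSY.
pose d (i j : 'I_m) : rat := if (i < j)%N then j%:R - i%:R else 1.
have VE (Z : {set 'I_m}) : Vandermonde_prod Z = \prod_(i in Z) \prod_(j in Z) d i j.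
  by apply: eq_bigr => i _; rewrite big_mkcondr.
rewrite !VE (eq_bigl [predU S & Y]) => [|i]; last by rewrite !inE.
rewrite bigU //=.
have split_in i : \prod_(j in S :|: Y) d i j = \prod_(j in S) d i j * \prod_(j in Y) d i j.
  rewrite (eq_bigl [predU S & Y]) => [|j]; last by rewrite !inE.
  by rewrite bigU.
under eq_bigr => i _ do rewrite split_in.
under [X in _ * X]eq_bigr => i _ do rewrite split_in.
rewrite !big_split /=.
have <- : (\prod_(i in S) \prod_(j in Y) d i j) * (\prod_(i in Y) \prod_(j in S) d i j)
    = \prod_(i in S) \prod_(j in Y) `|j%:R - i%:R|.
  rewrite [X in _ * X]exchange_big -big_split; apply: eq_bigr => i iS.
  rewrite -big_split; apply: eq_bigr => j jY /=.
  have ij : i != j by apply: contraTneq jY => <-; rewrite (disjointFr dSY).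
  rewrite /d; case: (ltngtP i j) => [lt_ij|lt_ji|/val_inj eq_ij].
  - by rewrite mulr1 ger0_norm // subr_ge0 ler_nat ltnW.
  - by rewrite mul1r distrC ger0_norm // subr_ge0 ler_nat ltnW.
  - by rewrite eq_ij eqxx in ij.
by ring.
Qed.

(** The reflection in the axis l, which is the map (a, b) |-> (a + b, - b) on
lattice points. *)
Definition flip (t : triangle) : triangle :=
  let: (a, b, up) := t in
  if up then (a + b, - b - 1, false) else (a + b + 1, - b - 1, true).

Lemma flipK : involutive flip.
Proof. by move=> [[a b] []] /=; congr (_, _, _); lia. Qed.

Lemma share_edge_flip t t' : share_edge (flip t) (flip t') = share_edge t t'.
Proof.
rewrite !share_edgeE; case: t t' => [[a b] []] [[c d] []] /=;
  rewrite !inE !xpair_eqE /=; lia.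
Qed.

Lemma mem_flip (R : {fset triangle}) t : (t \in flip @` R) = (flip t \in R).
Proof.
apply/imfsetP/idP => [[v /= vR ->]|tR]; first by rewrite flipK.
by exists (flip t); rewrite ?flipK.
Qed.

Lemma M_flip (R : {fset triangle}) : M (flip @` R) = M R.
Proof.
apply: (@M_iso R _ flip) => //; first by move=> ? ? _ _; apply: (can_inj flipK).
by move=> t t' _ _; apply: share_edge_flip.
Qed.

Lemma in_up_at m (S : {set 'I_m}) a b o :
  ((a, b, o) \in [fset up_at k | k in S]) = [&& o, b == 0, 0 <= a & absz a \in dents S].
Proof.
apply/imfsetP/and4P => [[k /= kS [-> -> ->]]|[o1 /eqP b0 a0 /mapP[k]]].
  by split=> //; rewrite mem_dents.
rewrite mem_enum => kS ak; exists k => //; congr (_, _, _) => //.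
by move: ak => /= <-; lia.
Qed.

Lemma flip_down_at m (k : 'I_m) : flip (down_at k) = up_at k.
Proof. by rewrite /flip /down_at /up_at; congr (_, _, _); lia. Qed.

Lemma in_down_at m (S : {set 'I_m}) t :
  (t \in [fset down_at k | k in S]) = (flip t \in [fset up_at k | k in S]).
Proof.
apply/imfsetP/imfsetP => -[k /= kS tk]; exists k => //; first by rewrite tk flip_down_at.
by apply: (can_inj flipK); rewrite flip_down_at.
Qed.

Lemma all_fset3 (P : pred point) (p q r : point) :
  all P [fset p; q; r] = [&& P p, P q & P r].
Proof.
apply/allP/and3P => [PA|[Pp Pq Pr] z]; first by split; apply: PA; rewrite !inE eqxx ?orbT.
by rewrite !inE => /orP[/orP[]|] /eqP ->.
Qed.

Lemma in_hexagonE x y n u d t :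
  (t \in hexagon x y n u d) = all (in_hexagon x y n u d) (vertices t).
Proof.
rewrite /hexagon !inE /=; case Ht : (all _ _); rewrite ?andbF ?andbT //.
case: t Ht => [[a b] o] Ht.
have [a_m b_m] : ((0 <= a) && (a < (x + y + n)%:Z)) /\
    ((- (y + d)%:Z <= b) && (b < (y + u)%:Z)).
  by move: Ht; case: o => /=; rewrite all_fset3 /in_hexagon /=; split; lia.
have wa : (absz a < x + y + n)%N by lia.
have hb : (absz (b + (y + d)%:Z)%R < (y + d) + (y + u))%N by lia.
apply/mapP; exists (Ordinal wa, Ordinal hb, o); first by rewrite mem_enum.
by congr (_, _, _) => /=; lia.
Qed.

Lemma H_halves x y n (U D : {set 'I_(x + y + n)}) :
  H x y n U D = trapezoid 0 (x + y + n) (y + #|U|) 0 (dents U) [::]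
    `|` flip @` trapezoid 0 (x + y + n) (y + #|D|) 0 (dents D) [::].
Proof.
apply/fsetP => -[[a b] o].
set T1 := trapezoid _ _ _ _ (dents U) _; set T2 := trapezoid _ _ _ _ (dents D) _.
have T1E t : t \in T1 = trapezoid_cond 0 (x + y + n) (y + #|U|) 0 (dents U) [::] t.
  exact: in_trapezoid.
have T2E t : t \in T2 = trapezoid_cond 0 (x + y + n) (y + #|D|) 0 (dents D) [::] t.
  exact: in_trapezoid.
rewrite /H in_fsetD in_hexagonE !in_fsetU in_down_at mem_flip T1E T2E.
have [o_up|o_down] := boolP o; rewrite /= !in_up_at all_fset3 /in_hexagon /=.
  have [b0|b0] := boolP (0 <= b).
    have [a0|a0] := boolP (0 <= a); last by lia.
    by lia.
  by lia.
by lia.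
Qed.

(** * The sum over the lozenges that cross the axis *)

(** Removing the upper halves of the straddling lozenges just makes more dents. *)
Lemma trapezoidD_up_at m h (S Y : {set 'I_m}) :
  trapezoid 0 m h 0 (dents S) [::] `\` [fset up_at k | k in Y] =
  trapezoid 0 m h 0 (dents (S :|: Y)) [::].
Proof.
apply/fsetP => -[[a b] o]; rewrite in_fsetD in_up_at !in_trapezoid /=.
by rewrite dentsU; case: o => /=; lia.
Qed.

(** The condition #|Y| = y comes from [trapezoid_unbalanced] for the upper
half. *)
Lemma M_H_split x y n (U D : {set 'I_(x + y + n)}) :
    (#|U| <= n)%N -> (#|D| <= n)%N ->
  M (H x y n U D) =
  (\sum_(Y : {set 'I_(x + y + n)} | (Y \subset ~: (U :|: D)) && (#|Y| == y))
     M (trapezoid 0 (x + y + n) (y + #|U|) 0 (dents (U :|: Y)) [::]) *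
     M (trapezoid 0 (x + y + n) (y + #|D|) 0 (dents (D :|: Y)) [::]))%N.
Proof.
move: U D; set m := (x + y + n)%N => U D Un Dn.
pose A := trapezoid 0 m (y + #|U|) 0 (dents U) [::].
pose B := flip @` trapezoid 0 m (y + #|D|) 0 (dents D) [::].
have inA t : (t \in A) = trapezoid_cond 0 m (y + #|U|) 0 (dents U) [::] t.
  exact: in_trapezoid.
have inB t : (t \in B) = trapezoid_cond 0 m (y + #|D|) 0 (dents D) [::] (flip t).
  by rewrite mem_flip in_trapezoid.
have upI : injective (@up_at m).
  by move=> k k' [kk']; apply: val_inj.
have downI : injective (@down_at m).
  by move=> k k' [kk']; apply: val_inj.
have inAk (k : 'I_m) : (up_at k \in A) = (0 < y + #|U|)%N && (k \notin U).
  by rewrite inA /= mem_dents; have := ltn_ord k; case: (k \notin U); lia.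
have inBk (k : 'I_m) : (down_at k \in B) = (0 < y + #|D|)%N && (k \notin D).
  by rewrite inB flip_down_at /= mem_dents; have := ltn_ord k; case: (k \notin D); lia.
rewrite H_halves (@M_split _ (@up_at m) (@down_at m) A B) //; first last.
- move=> [[a b] o] [[c d] o']; rewrite inA inB share_edgeE => tA vB tv.
  have /and3P[a0 am bd] : [&& 0 <= a, a < m%:Z & (0 <= b) && (d < 0)].
    by clear tv; move: tA vB; case: o; case: o' => /=; lia.
  have /and5P[/eqP -> /eqP -> /eqP -> /eqP -> /eqP ->] :
      [&& o == true, o' == false, b == 0, d == -1 & c == a].
    clear tA vB; move: tv bd.
    by case: o; case: o' => /=; rewrite !inE !xpair_eqE /=; lia.
  have ka : (absz a < m)%N by lia.
  by exists (Ordinal ka); split; congr (_, _, _) => /=; lia.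
- move=> [[a b] o]; rewrite inA inB; case: o => /=; lia.
- by move=> k; rewrite share_edgeE /up_at /down_at /= !inE eqxx !orbT.
rewrite (bigID (fun Y : {set 'I_m} => #|Y| == y)) /= [X in (_ + X)%N]big1 ?addn0.
  apply: eq_big => [Y|Y _].
    apply: andb_id2r => /eqP cY; apply/forall_inP/subsetP => H k kY.
      have := H k kY; rewrite inAk inBk !inE.
      by case: (k \in U); case: (k \in D); rewrite ?andbF.
    have y0 : (0 < #|Y|)%N by apply/card_gt0P; exists k.
    have := H k kY; rewrite inAk inBk !inE negb_or => /andP[-> ->].
    by rewrite -cY !addn_gt0 y0.
  rewrite trapezoidD_up_at; congr (_ * _)%N.
  rewrite -[RHS]M_flip -trapezoidD_up_at; congr M; apply/fsetP => t.
  by rewrite [RHS]mem_flip !in_fsetD in_down_at /B mem_flip.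
move=> Y /andP[/forall_inP vY Yy].
have disj : #|U :|: Y| = (#|U| + #|Y|)%N.
  rewrite cardsU (_ : U :&: Y = set0) ?cards0 ?subn0 //.
  apply/setP => k; rewrite !inE; case kY : (k \in Y); rewrite ?andbF // andbT.
  by have := vY k kY; rewrite inAk => /andP[/andP[_ /negPf]].
rewrite trapezoidD_up_at (@trapezoid_unbalanced (y + #|U|)) ?mul0n //.
- apply/andP; split; last by apply: leq_trans (leq_add (leqnn y) Un) _; rewrite /m; lia.
  rewrite lt0n; apply: contraNN Yy => /eqP h0.
  (* An empty upper half has no position to straddle from. *)
  rewrite (_ : Y = set0) ?cards0; first by lia.
  by apply/setP => k; rewrite inE; apply/negP => /vY; rewrite inAk h0.
- exact: dents_sorted.
- exact: dents_lt.
by rewrite size_dents disj addnC eqn_add2r.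
Qed.

Lemma M_trapezoid_dents m (S : {set 'I_m}) :
  (M (trapezoid 0 m #|S| 0 (dents S) [::]))%:R =
  Vandermonde_prod S / \prod_(j < #|S|) (j`!)%:R.
Proof.
rewrite M_trapezoid ?size_dents ?dents_sorted ?dents_lt //.
rewrite -binom_det_dents mulfK //; apply/prodf_neq0 => j _.
by rewrite pnatr_eq0 -lt0n fact_gt0.
Qed.

(** The factor of the number of tilings that depends on U and D only through
C = U :|: D and I = U :&: D. *)
Definition mixed_sum (m y : nat) (C I : {set 'I_m}) : rat :=
  \sum_(Y : {set 'I_m} | (Y \subset ~: C) && (#|Y| == y))
     Vandermonde_prod Y ^+ 2 *
     ((\prod_(i in C) \prod_(j in Y) `|j%:R - i%:R|) *
      (\prod_(i in I) \prod_(j in Y) `|j%:R - i%:R|)).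

(** There are at least y positions outside C, and every term is positive. *)
Lemma mixed_sum_gt0 m y (C I : {set 'I_m}) : I \subset C -> (y + #|C| <= m)%N ->
  0 < mixed_sum y C I.
Proof.
move=> IC yC.
have dist_gt0 (S Y : {set 'I_m}) : S \subset C -> Y \subset ~: C ->
    0 < \prod_(i in S) \prod_(j in Y) `|j%:R - i%:R| :> rat.
  move=> SC YC; apply: prodr_gt0 => i iS; apply: prodr_gt0 => j jY.
  rewrite normr_gt0 subr_eq0 eqr_nat; apply/eqP => /val_inj ji.
  by have := subsetP YC _ jY; rewrite inE ji (subsetP SC).
have term_gt0 (Y : {set 'I_m}) : Y \subset ~: C -> 0 < Vandermonde_prod Y ^+ 2 *
     ((\prod_(i in C) \prod_(j in Y) `|j%:R - i%:R|) *
      (\prod_(i in I) \prod_(j in Y) `|j%:R - i%:R|)).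
  by move=> YC; rewrite !mulr_gt0 ?exprn_gt0 ?Vandermonde_prod_gt0 ?dist_gt0.
have : (0 < #|[set Y : {set 'I_m} | Y \subset ~: C & #|Y| == y]|)%N.
  rewrite cards_draws bin_gt0 cardsCs setCK card_ord; lia.
rewrite card_gt0 => /set0Pn[Y0]; rewrite inE => Y0C.
rewrite /mixed_sum (bigD1 Y0) //= ltr_pwDl ?term_gt0 //; first by case/andP: Y0C.
by apply: sumr_ge0 => Y /andP[/andP[YC _] _]; apply/ltW/term_gt0.
Qed.

(** A product over U times one over D equals the product over U :|: D times the
one over U :&: D; this is why the sum over Y sees only these two sets. *)
Lemma M_H_formula x y n (U D : {set 'I_(x + y + n)}) :
    (#|U| <= n)%N -> (#|D| <= n)%N ->
  (M (H x y n U D))%:R =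
  Vandermonde_prod U * Vandermonde_prod D * mixed_sum y (U :|: D) (U :&: D) /
  ((\prod_(j < y + #|U|) (j`!)%:R) * (\prod_(j < y + #|D|) (j`!)%:R)).
Proof.
move=> Un Dn; rewrite M_H_split // natr_sum mulr_sumr mulr_suml.
apply: eq_bigr => Y /andP[YC /eqP cY].
have dUD (S : {set 'I_(x + y + n)}) : S \subset U :|: D -> [disjoint S & Y]%B.
  move=> SUD; rewrite disjoint_sym disjoints_subset; apply: subset_trans YC _.
  by rewrite setCS.
have cS (S : {set 'I_(x + y + n)}) : [disjoint S & Y]%B -> (y + #|S|)%N = #|S :|: Y|.
  by move=> /disjoint_setI0 SY; rewrite cardsU SY cards0 subn0 cY addnC.
have dU := dUD _ (subsetUl U D); have dD := dUD _ (subsetUr U D).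
rewrite natrM !cS // !M_trapezoid_dents mulf_div; congr (_ / _).
rewrite !Vandermonde_prodU //.
have -> : (\prod_(i in U :|: D) \prod_(j in Y) `|j%:R - i%:R|) *
      (\prod_(i in U :&: D) \prod_(j in Y) `|j%:R - i%:R|) =
    (\prod_(i in U) \prod_(j in Y) `|j%:R - i%:R|) *
      (\prod_(i in D) \prod_(j in Y) `|j%:R - i%:R|) :> rat.
  rewrite [X in _ * X]big_mkcond [X in X * _]big_mkcond [X in _ = X * _]big_mkcond.
  rewrite [X in _ = _ * X]big_mkcond -!big_split /=; apply: eq_bigr => i _.
  by rewrite !inE; case: (i \in U); case: (i \in D); rewrite ?mulr1 ?mul1r.
by ring.
Qed.

Theorem theorem2p1 (x y n u d : nat) (hu : (u <= n)%N) (hd : (d <= n)%N)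
    (U D U' D' : {set 'I_(x + y + n)})
    (s s' : 'I_u -> 'I_(x + y + n)) (t t' : 'I_d -> 'I_(x + y + n))
    (s_incr : {homo s : i j / (i < j)%N}) (t_incr : {homo t : i j / (i < j)%N})
    (s'_incr : {homo s' : i j / (i < j)%N})
    (t'_incr : {homo t' : i j / (i < j)%N})
    (hU : U = [set s i | i : 'I_u]) (hD : D = [set t i | i : 'I_d])
    (hU' : U' = [set s' i | i : 'I_u]) (hD' : D' = [set t' i | i : 'I_d])
    (hn : #|U :|: D| = n)
    (hcup : U :|: D = U' :|: D') (hcap : U :&: D = U' :&: D') :
  (M (H x y n U D))%:R / (M (H x y n U' D'))%:R =
  (\prod_(i < u) \prod_(j < u | (i < j)%N)
      (((s j)%:R - (s i)%:R) / ((s' j)%:R - (s' i)%:R))) *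
  (\prod_(i < d) \prod_(j < d | (i < j)%N)
      (((t j)%:R - (t i)%:R) / ((t' j)%:R - (t' i)%:R))) :> rat.
Proof.
have prod_ratio k (f f' : 'I_k -> 'I_(x + y + n)) :
    {homo f : i j / (i < j)%N} -> {homo f' : i j / (i < j)%N} ->
    \prod_(i < k) \prod_(j < k | (i < j)%N)
      (((f j)%:R - (f i)%:R) / ((f' j)%:R - (f' i)%:R)) =
    Vandermonde_prod [set f i | i : 'I_k] / Vandermonde_prod [set f' i | i : 'I_k].
  move=> f_incr f'_incr; rewrite !Vandermonde_prod_imset // -prodf_div.
  by apply: eq_bigr => i _; rewrite prodf_div.
rewrite !prod_ratio // -hU -hU' -hD -hD'.
have card_im k (f : 'I_k -> 'I_(x + y + n)) :
    {homo f : i j / (i < j)%N} -> #|[set f i | i : 'I_k]| = k.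
  move=> f_incr; rewrite card_imset ?card_ord // => i j fij; apply: val_inj.
  by case: (ltngtP i j) => // /f_incr; rewrite fij ltnn.
have cU : #|U| = u by rewrite hU card_im.
have cU' : #|U'| = u by rewrite hU' card_im.
have cD : #|D| = d by rewrite hD card_im.
have cD' : #|D'| = d by rewrite hD' card_im.
rewrite !M_H_formula ?cU ?cU' ?cD ?cD' // -hcup -hcap.
set K := mixed_sum _ _ _.
have K0 : K != 0.
  apply/lt0r_neq0/mixed_sum_gt0; first exact: subset_trans (subsetIl _ _) (subsetUl _ _).
  by rewrite hn; lia.
set c : rat := (\prod_(j < y + u) (j`!)%:R) * (\prod_(j < y + d) (j`!)%:R).
have c0 : c != 0.
  rewrite mulf_neq0 //; apply/prodf_neq0 => j _; rewrite pnatr_eq0 -lt0n fact_gt0 //.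
have U'0 := lt0r_neq0 (Vandermonde_prod_gt0 U').
have D'0 := lt0r_neq0 (Vandermonde_prod_gt0 D').
by field; rewrite K0 c0 U'0 D'0.
Qed.
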